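(* Let $P,\nu\in\mathcal P(\Xi)$ and consider the optimal values $$v(P)=\min_{x\in X}\{g(x)+\mathbb E_P[Q(x,\xi)]\},\qquad v(\nu)=\min_{x\in X}\{g(x)+\mathbb E_\nu[Q(x,\xi)]\}.$$ Assume: (i) (well-posedness) for every $\mu\in\mathcal P(\Xi)$ such that $\mathbb E_\mu[|Q(x,\xi)|]<\infty$ for all $x\in X$, the problem $\min_{x\in X}\{g(x)+\mathbb E_\mu[Q(x,\xi)]\}$ has an optimal solution (a minimizer with finite objective value); (ii) (integrability) for each $x\in X$, the function $\xi\mapsto Q(x,\xi)$ is measurable, and $\mathbb E_P[|Q(x,\xi)|]<\infty$ and $\mathbb E_\nu[|Q(x,\xi)|]<\infty$; (iii) (regret domination) there are a (measurable, lower semicontinuous) function $c:\Xi\times\Xi\to[0,+\infty]$ and a constant $\beta>0$ such that $$R(\xi,\xi'):=\sup_{x\in X}[Q(x,\xi)-Q(x,\xi')]\le \beta\, c(\xi,\xi')\qquad\text{for all }\xi,\xi'\in\Xi.$$ Then $$v(P)-v(\nu)\le\beta\,\mathcal T_c(P,\nu)\quad\text{and}\quad v(\nu)-v(P)\le\beta\,\mathcal T_c(\nu,P),$$ and therefore $$|v(P)-v(\nu)|\le\beta\max\{\mathcal T_c(P,\nu),\mathcal T_c(\nu,P)\}.$$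
   Context: $\Xi\subseteq\mathbb R^d$ is the set of scenarios, and $\mathcal P(\Xi)$ is the set of Borel probability measures on $\Xi$. The first-stage feasible set $X\subseteq\mathbb R^{n_1}$ is closed and nonempty, and $g:\mathbb R^{n_1}\to\mathbb R\cup\{+\infty\}$ is proper, lower semicontinuous and coercive. The second-stage (recourse) value function is the real-valued function $$Q(x,\xi)=\min_{z\in Z(x,\xi)}\kappa(z;x,\xi),\qquad (x,\xi)\in X\times\Xi,$$ where $Z(x,\xi)\subseteq\mathbb R^{n_2}$ is nonempty for every $(x,\xi)\in X\times\Xi$ (relatively complete recourse), the cost $\kappa:\mathbb R^{n_2}\times\mathbb R^{n_1}\times\Xi\to\mathbb R$ is measurable in $\xi$ and lower semicontinuous in $(z,x)$, and the minimum is attained. For $\mu\in\mathcal P(\Xi)$, $\mathbb E_\mu[Q(x,\xi)]=\int_\Xi Q(x,\xi)\,d\mu(\xi)$. For $\mu,\mu'\in\mathcal P(\Xi)$, $\Pi(\mu,\mu')$ is the set of couplings, i.e. Borel probability measures on $\Xi\times\Xi$ with first marginal $\mu$ and second marginal $\mu'$, and the optimal transport cost is $$\mathcal T_c(\mu,\mu')=\inf_{\pi\in\Pi(\mu,\mu')}\int_{\Xi\times\Xi}c(\xi,\xi')\,d\pi(\xi,\xi')\in[0,+\infty].$$ The cost $c$ is not assumed to be symmetric or to satisfy the triangle inequality. *)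

(* Defs.v *)
From HB Require Import structures.
From mathcomp Require Import all_boot all_order all_algebra.
From mathcomp Require Import all_classical all_reals all_analysis measurable_realfun.
Import Order.TTheory GRing.Theory Num.Theory.
Import numFieldNormedType.Exports.

Set Implicit Arguments.
Unset Strict Implicit.
Unset Printing Implicit Defensive.

Local Open Scope classical_set_scope.
Local Open Scope ring_scope.
Local Open Scope ereal_scope.

(* The set [Xi] as a type, with the topology induced by the ambient space.
   The library's measurable types are pointed, hence the proof [Xi0] that [Xi]
   is nonempty, without which there is no probability measure on [Xi] anyway. *)
Definition scenario (V : topologicalType) (Xi : set V) (Xi0 : Xi !=set0) : Type :=
  set_type Xi.

Section scenario_instances.
Variables (V : topologicalType) (Xi : set V) (Xi0 : Xi !=set0).

Lemma scenario_inhabited : exists _ : scenario Xi0, True.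
Proof. by case: Xi0 => v Xiv; exists (exist _ v (mem_set Xiv)). Qed.

HB.instance Definition _ :=
  Topological.copy (scenario Xi0) (set_type Xi).
HB.instance Definition _ :=
  isPointed.Build (scenario Xi0) (projT1 (cid scenario_inhabited)).

End scenario_instances.

HB.instance Definition _ (T U : ptopologicalType) := Pointed.on (T * U)%type.

Notation borel T := (g_sigma_algebraType (@open T)).

Definition borel_measurable (T : ptopologicalType) (d : measure_display)
    (U : measurableType d) (f : T -> U) : Prop :=
  measurable_fun [set: borel T] (f : borel T -> U).

Section optimal_transport.
Variables (R : realType) (T : ptopologicalType).

(* Borel sets of the product space [T * T] (with the product topology) are used
   here, rather than the product sigma-algebra; no countability assumption on
   the topology of [T] is therefore involved. Marginals are compared on Borel
   sets only, since the values of a library measure elsewhere are irrelevant. *)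
Definition coupling (mu mu' : probability (borel T) R)
    (pi : probability (borel (T * T)%type) R) : Prop :=
  forall A : set (borel T), measurable A ->
    pi (fst @^-1` A) = mu A /\ pi (snd @^-1` A) = mu' A.

Definition transport_cost (c : T * T -> \bar R)
    (mu mu' : probability (borel T) R) : \bar R :=
  ereal_inf [set \int[pi]_p c p | pi in coupling mu mu'].

End optimal_transport.

Section extended_real_functions.
Variables (R : realType) (V : normedModType R).
Implicit Type g : V -> \bar R.

Definition proper_fun g : Prop :=
  (forall x, g x != -oo) /\ (exists x, g x != +oo).

(* g x --> +oo as `|x| --> +oo *)
Definition coercive g : Prop :=
  forall M : R, exists r : R, forall x, (r < `|x|)%R -> M%:E <= g x.

End extended_real_functions.

Section two_stage.
Variables (R : realType) (T : ptopologicalType) (V1 V2 : Type).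

(* The real infimum [inf] is the minimum as soon as the latter is attained. *)
Definition recourse (Z : V1 -> T -> set V2) (kappa : V2 -> V1 -> T -> R)
    (x : V1) (xi : T) : R :=
  inf [set kappa z x xi | z in Z x xi].

Definition objective (g : V1 -> \bar R) (Q : V1 -> T -> R)
    (mu : probability (borel T) R) (x : V1) : \bar R :=
  g x + 'E_mu[Q x].

Definition has_optimal_solution (X : set V1) (f : V1 -> \bar R) : Prop :=
  exists2 x, X x & f x \is a fin_num /\ forall y, X y -> f x <= f y.

Definition optimal_value (X : set V1) (g : V1 -> \bar R) (Q : V1 -> T -> R)
    (mu : probability (borel T) R) : \bar R :=
  ereal_inf [set objective g Q mu x | x in X].

Definition regret (X : set V1) (Q : V1 -> T -> R) (xi xi' : T) : \bar R :=
  ereal_sup [set (Q x xi - Q x xi')%:E | x in X].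

End two_stage.

(* Main.v *)
Require Import Defs.
From HB Require Import structures.
From mathcomp Require Import all_boot all_order all_algebra.
From mathcomp Require Import all_classical all_reals all_analysis measurable_realfun.
Import Order.TTheory GRing.Theory Num.Theory.
Import numFieldNormedType.Exports.

Set Implicit Arguments.
Unset Strict Implicit.
Unset Printing Implicit Defensive.

Local Open Scope classical_set_scope.
Local Open Scope ring_scope.
Local Open Scope ereal_scope.

(** Let [x] minimize the problem under [mu']. Using this same [x] as a feasible
    point under [mu] gives
      v mu - v mu' <= (g x + E_mu[Q x]) - (g x + E_mu'[Q x])
                    = E_mu[Q x] - E_mu'[Q x],
    where the terms [g x] cancel because they are finite at a minimizer. For any
    coupling [pi] of [mu] and [mu'], the marginal conditions turn the last
    difference into the integral of [Q x xi - Q x xi'] against [pi]; the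
    integrand is at most the regret, hence at most [beta * c], and the infimum
    over [pi] gives [beta * transport_cost c mu mu'] as a bound
    ([optimal_value_gap_le_transport_cost]). The two one-sided bounds are the
    two orientations of this lemma, and the bound on the absolute value is their
    combination, both optimal values being finite. *)

Section marginals.
Context d1 d2 (T : measurableType d1) (U : measurableType d2) (R : realType).
Variables (phi : T -> U) (mphi : measurable_fun [set: T] phi).
Variables (m : {measure set T -> \bar R}) (mu : {measure set U -> \bar R}).
Hypothesis phi_mu : forall A, measurable A -> m (phi @^-1` A) = mu A.
Variable f : U -> \bar R.
Hypothesis fi : mu.-integrable [set: U] f.

(** A coupling knows its marginals on measurable sets only, hence the form of
    [phi_mu]. Integrability passes from [mu] back to [m], which is what makes a
    difference of two marginal integrals a single integral against the
    coupling. *)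
Lemma integrable_marginal : m.-integrable [set: T] (f \o phi).
Proof.
have [mf foo] := integrableP _ _ _ fi.
apply/integrableP; split; first exact: measurableT_comp mf mphi.
rewrite -[X in X < _](ge0_integral_pushforward mphi m measurableT
  (f := fun u => `|f u|)) //; last exact: measurableT_comp mf.
by rewrite (eq_measure_integral mu) // => A mA _; exact: phi_mu.
Qed.

Lemma integral_marginal : \int[m]_t f (phi t) = \int[mu]_u f u.
Proof.
have [mf _] := integrableP _ _ _ fi.
rewrite -[LHS](integral_pushforward mphi mf integrable_marginal measurableT).
by apply: eq_measure_integral => A mA _; exact: phi_mu.
Qed.

End marginals.

(** Makes the coordinate projections measurable for the Borel sigma-algebra of
    the product topology, which can be larger than the product of the Borel
    sigma-algebras. *)
Lemma continuous_borel_measurable (T U : ptopologicalType) (f : T -> U) :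
  continuous f -> measurable_fun [set: borel T] (f : borel T -> borel U).
Proof.
move=> /continuousP cf.
apply: (@measurability _ _ (borel T) (borel U) _ f (@open U)) => //.
move=> _ [A oA <-]; rewrite setTI; apply: sub_sigma_algebra.
exact: cf.
Qed.

Lemma integrable_expectation_norm (R : realType) d (T : measurableType d)
    (mu : probability T R) (q : T -> R) :
  measurable_fun [set: T] q -> 'E_mu[fun t => `|q t|%R] < +oo ->
  mu.-integrable [set: T] (EFin \o q).
Proof.
move=> mq; rewrite unlock => qoo; apply/integrableP; split => //.
exact/measurable_EFinP.
Qed.

Lemma ereal_inf_attained (R : realType) (V : Type) (X : set V)
    (f : V -> \bar R) (x : V) :
  X x -> (forall y, X y -> f x <= f y) -> ereal_inf [set f y | y in X] = f x.
Proof.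
move=> Xx fx; apply/eqP; rewrite eq_le; apply/andP; split.
  by apply: ereal_inf_lbound; exists x.
by apply: le_ereal_inf_tmp => _ [y Xy <-]; exact: fx.
Qed.

Section regret_bound.
Variables (R : realType) (T : ptopologicalType).
Variables (mu mu' : probability (borel T) R).
Variables (c : T * T -> \bar R) (beta : R).
Hypotheses (c0 : forall p, 0 <= c p) (mc : borel_measurable c).
Hypothesis beta0 : (0 < beta)%R.

(** The easy half of Kantorovich duality: the pair [(q, - q)] is feasible for
    the dual problem with cost [beta * c], hence its dual value is a lower bound
    on the transport cost. *)
Lemma expectation_gap_le_transport_cost (q : borel T -> R) :
  mu.-integrable [set: borel T] (EFin \o q) ->
  mu'.-integrable [set: borel T] (EFin \o q) ->
  (forall t t', (q t - q t')%:E <= beta%:E * c (t, t')) ->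
  'E_mu[q] - 'E_mu'[q] <= beta%:E * transport_cost c mu mu'.
Proof.
move=> qmu qmu' qc; rewrite unlock -lee_pdivrMl//.
apply: le_ereal_inf_tmp => _ [pi pi_coupling <-]; rewrite lee_pdivrMl//.
pose p1 : borel (T * T)%type -> borel T := fst.
pose p2 : borel (T * T)%type -> borel T := snd.
have mp1 : measurable_fun [set: borel (T * T)%type] p1.
  by apply: continuous_borel_measurable => p; exact: cvg_fst.
have mp2 : measurable_fun [set: borel (T * T)%type] p2.
  by apply: continuous_borel_measurable => p; exact: cvg_snd.
have pi_p1 A : measurable A -> pi (p1 @^-1` A) = mu A.
  by case/(pi_coupling A).
have pi_p2 A : measurable A -> pi (p2 @^-1` A) = mu' A.
  by case/(pi_coupling A).
rewrite -(integral_marginal mp1 pi_p1 qmu).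
rewrite -(integral_marginal mp2 pi_p2 qmu').
have qp1 := integrable_marginal mp1 pi_p1 qmu.
have qp2 := integrable_marginal mp2 pi_p2 qmu'.
rewrite -integralB//.
(* When [c] has an infinite integral the bound is [+oo]; otherwise [c] is
   integrable and monotonicity of the integral applies. *)
have [c_oo|c_fin] := leP +oo (\int[pi]_p c p).
  by move: c_oo; rewrite leye_eq => /eqP ->; rewrite gt0_muley ?lte_fin// leey.
rewrite -ge0_integralZl_EFin//; last exact: ltW.
apply: le_integral => //.
- exact: integrableB.
- apply: integrableZl => //; apply/integrableP; split => //.
  by under eq_integral do rewrite gee0_abs//.
- by move=> [t t'] _; exact: qc.
Qed.

(** A minimizer under [mu'] is a feasible but possibly suboptimal choice under
    [mu], so the gap between the optimal values is at most the gap between the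
    objectives at that single point. *)
Lemma optimal_value_gap_le_transport_cost (V : Type) (X : set V)
    (g : V -> \bar R) (Q : V -> T -> R) :
  (forall x, X x -> mu.-integrable [set: borel T] (EFin \o Q x)) ->
  (forall x, X x -> mu'.-integrable [set: borel T] (EFin \o Q x)) ->
  has_optimal_solution X (objective g Q mu') ->
  (forall t t', regret X Q t t' <= beta%:E * c (t, t')) ->
  optimal_value X g Q mu - optimal_value X g Q mu' <=
    beta%:E * transport_cost c mu mu'.
Proof.
move=> Qmu Qmu' [x Xx [xfin xmin]] Qc.
have Efin : 'E_mu[Q x] \is a fin_num.
  by rewrite unlock; exact: integrable_fin_num (Qmu x Xx).
have E'fin : 'E_mu'[Q x] \is a fin_num.
  by rewrite unlock; exact: integrable_fin_num (Qmu' x Xx).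
have gfin : g x \is a fin_num.
  by move: xfin; rewrite /objective fin_numD => /andP[].
apply: (@le_trans _ _ ('E_mu[Q x] - 'E_mu'[Q x])); last first.
  apply: expectation_gap_le_transport_cost; [exact: Qmu|exact: Qmu'|].
  move=> t t'; apply: le_trans (Qc t t').
  by apply: ereal_sup_ubound; exists x.
rewrite {2}/optimal_value (ereal_inf_attained Xx xmin) leeBlDr// /objective.
have -> : 'E_mu[Q x] - 'E_mu'[Q x] + (g x + 'E_mu'[Q x]) = objective g Q mu x.
  by rewrite /objective addeCA subeK.
by apply: ereal_inf_lbound; exists x.
Qed.

End regret_bound.

Theorem theorem4p3 (R : realType) (d n1 n2 : nat)
    (Xi : set 'rV[R]_d) (Xi0 : Xi !=set0)
    (X : set 'rV[R]_n1) (g : 'rV[R]_n1 -> \bar R)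
    (Z : 'rV[R]_n1 -> scenario Xi0 -> set 'rV[R]_n2)
    (kappa : 'rV[R]_n2 -> 'rV[R]_n1 -> scenario Xi0 -> R)
    (P nu : probability (borel (scenario Xi0)) R)
    (c : scenario Xi0 * scenario Xi0 -> \bar R) (beta : R) :
  let Q := recourse Z kappa in
  let v := optimal_value X g Q in
  closed X -> X !=set0 ->
  proper_fun g -> lower_semicontinuous g -> coercive g ->
  (forall x xi, X x -> Z x xi !=set0) ->
  (forall z x, borel_measurable (kappa z x)) ->
  (forall xi, lower_semicontinuous
    (fun zx : 'rV[R]_n2 * 'rV[R]_n1 => (kappa zx.1 zx.2 xi)%:E)) ->
  (forall x xi, X x -> exists2 z, Z x xi z &
    forall z', Z x xi z' -> (kappa z x xi <= kappa z' x xi)%R) ->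
  (* (i) well-posedness *)
  (forall mu : probability (borel (scenario Xi0)) R,
    (forall x, X x -> 'E_mu[fun xi => `|Q x xi|%R] < +oo) ->
    has_optimal_solution X (objective g Q mu)) ->
  (* (ii) integrability *)
  (forall x, X x -> [/\ borel_measurable (Q x),
    'E_P[fun xi => `|Q x xi|%R] < +oo & 'E_nu[fun xi => `|Q x xi|%R] < +oo]) ->
  (* (iii) regret domination *)
  (forall p, 0 <= c p) ->
  borel_measurable c ->
  lower_semicontinuous c ->
  (0 < beta)%R ->
  (forall xi xi', regret X Q xi xi' <= beta%:E * c (xi, xi')) ->
  [/\ v P - v nu <= beta%:E * transport_cost c P nu,
      v nu - v P <= beta%:E * transport_cost c nu P &
      `|v P - v nu| <=
        beta%:E * maxe (transport_cost c P nu) (transport_cost c nu P)].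
Proof.
move=> Q v _ _ _ _ _ _ _ _ _ wellposed Qint c0 mc _ beta0 Qc.
have QP x : X x -> P.-integrable [set: borel (scenario Xi0)] (EFin \o Q x).
  by case/(Qint x) => mQ QP _; exact: integrable_expectation_norm.
have Qnu x : X x -> nu.-integrable [set: borel (scenario Xi0)] (EFin \o Q x).
  by case/(Qint x) => mQ _ Qnu; exact: integrable_expectation_norm.
have solP : has_optimal_solution X (objective g Q P).
  by apply: wellposed => x /Qint[].
have solnu : has_optimal_solution X (objective g Q nu).
  by apply: wellposed => x /Qint[].
have gapP : v P - v nu <= beta%:E * transport_cost c P nu.
  exact: optimal_value_gap_le_transport_cost.
have gapnu : v nu - v P <= beta%:E * transport_cost c nu P.
  exact: optimal_value_gap_le_transport_cost.
split => //.
rewrite maxe_pMr ?lee_fin ?(ltW beta0)//.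
have vfin (mu : probability (borel (scenario Xi0)) R) :
    has_optimal_solution X (objective g Q mu) -> v mu \is a fin_num.
  by case=> x Xx [xfin xmin]; rewrite /v /optimal_value (ereal_inf_attained Xx).
rewrite le_max; have [gap0|gap0] := leP 0 (v P - v nu).
  by rewrite gee0_abs// gapP.
by rewrite lte0_abs// fin_num_oppeB ?vfin// addeC gapnu orbT.
Qed.
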